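(* Let $(\mathfrak Q,\mathfrak P)$ be an adjoint pair, where $\mathfrak P\colon\mathbf{Prd}\to\mathbf{Gpd\text{-}PreOrd}$ is the functor sending a protorootoid to its underlying groupoid-preorder and $\mathfrak Q\colon\mathbf{Gpd\text{-}PreOrd}\to\mathbf{Prd}$ is its left adjoint, with unit $\eta\colon\mathrm{Id}\to\mathfrak P\mathfrak Q$ and counit $\epsilon\colon\mathfrak Q\mathfrak P\to\mathrm{Id}$. Let $\mathbf{Gpd\text{-}PreOrd}_P$ be the full subcategory of $\mathbf{Gpd\text{-}PreOrd}$ with objects the groupoid-preorders of the form $\mathfrak P(\mathcal R)$ for some protorootoid $\mathcal R$, and let $\mathbf{Prd}_F$ be the full subcategory of $\mathbf{Prd}$ with objects those $\mathcal R$ such that $\epsilon_{\mathcal R}$ is an isomorphism. Then: (a) An object $a$ of $\mathbf{Gpd\text{-}PreOrd}$ is in $\mathbf{Gpd\text{-}PreOrd}_P$ if and only if $\eta_a$ is an isomorphism in $\mathbf{Gpd\text{-}PreOrd}$. (b) $\mathfrak Q$ and $\mathfrak P$ restrict to an adjoint equivalence between $\mathbf{Gpd\text{-}PreOrd}_P$ and $\mathbf{Prd}_F$. (c) A protorootoid is in $\mathbf{Prd}_F$ if and only if it is isomorphic to one of the form $\mathfrak Q(a)$ for some object $a$ of $\mathbf{Gpd\text{-}PreOrd}_P$.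
   Context: Boolean rings are possibly non-unital rings in which $x^2=x$, with ring homomorphisms (not necessarily unital) as morphisms; they are ordered by $x\subseteq y$ iff $xy=x$. For a (small) groupoid $G$ and $a,b\in\mathrm{ob}(G)$, write ${}_aG_b:=\mathrm{Hom}_G(b,a)$ and ${}_aG:=\bigcup_b{}_aG_b$. A protorootoid is a triple $(G,\Lambda,N)$ with $G$ a groupoid, $\Lambda$ a functor from $G$ to Boolean rings, and $N$ a $1$-cocycle: $N(g)\in\Lambda(a)$ for $g\in{}_aG$, and $N(gh)=N(g)+\Lambda(g)(N(h))$ whenever $gh$ is defined. A morphism $(G,\Lambda,N)\to(H,\Gamma,M)$ is a pair $(\alpha,\nu)$ of a groupoid homomorphism $\alpha\colon G\to H$ and a natural transformation $\nu\colon\Lambda\to\Gamma\alpha$ with $\nu_a(N(g))=M(\alpha(g))$ for all $g\in{}_aG$. This gives the category $\mathbf{Prd}$. The weak right preorder at $a$ is the preorder on ${}_aG$ given by $x\leq y$ iff $N(x)\subseteq N(y)$. A groupoid-preorder is a pair $(G,\leq)$ of a groupoid $G$ and a family of preorders, one on each set ${}_aG$, $a\in\mathrm{ob}(G)$. A morphism $(G,\leq)\to(H,\leq)$ is a groupoid homomorphism $\alpha\colon G\to H$ such that each induced map ${}_aG\to{}_{\alpha(a)}H$ is order preserving. This gives the category $\mathbf{Gpd\text{-}PreOrd}$. The functor $\mathfrak P$ sends $(G,\Lambda,N)$ to $(G,\leq)$ with $\leq$ the family of weak right preorders, and sends $(\alpha,\nu)$ to $\alpha$. The left adjoint $\mathfrak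 Q$ of $\mathfrak P$ is realized as follows: $\mathfrak Q(G,\leq)=(G,\Lambda,N)$, where $\Lambda(a)$ is the Boolean ring generated by symbols $(a,x,y)$ for $x\in{}_aG_b$, $y\in{}_bG$, $b\in\mathrm{ob}(G)$, subject to the relations $(a,x,yz)+(a,x,y)+(a,xy,z)=0$ for $x\in{}_aG_b$, $y\in{}_bG_c$, $z\in{}_cG_d$, and $(a,x,y)(a,x,z)+(a,x,y)=0$ for $x\in{}_aG_b$ and $y,z\in{}_bG$ with $y\leq z$; $\Lambda(g)(a,x,y)=(b,gx,y)$ for $g\in{}_bG_a$; and $N(g)=(a,1_a,g)$ for $g\in{}_aG$. The unit $\eta_{(G,\leq)}\colon(G,\leq)\to\mathfrak P\mathfrak Q(G,\leq)$ is the identity of $G$ on underlying groupoids. *)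

(* Defs.v *)
From HB Require Import structures.
From Corelib Require Import RelationClasses.
From mathcomp Require Import all_boot all_algebra.
From mathcomp Require Import boolp.

Set Implicit Arguments.
Unset Strict Implicit.
Unset Printing Implicit Defensive.

Import GRing.Theory.
Local Open Scope ring_scope.
#[local] Obligation Tactic := idtac.

Record category := Category {
  cob :> Type;
  chom : cob -> cob -> Type;
  cid : forall a, chom a a;
  ccomp : forall a b c, chom b c -> chom a b -> chom a c;
  ccompA : forall a b c d (h : chom c d) (g : chom b c) (f : chom a b),
    ccomp h (ccomp g f) = ccomp (ccomp h g) f;
  ccomp1f : forall a b (f : chom a b), ccomp (cid b) f = f;
  ccompf1 : forall a b (f : chom a b), ccomp f (cid a) = f
}.

Definition is_iso (C : category) (a b : C) (f : chom a b) : Prop :=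
  exists g : chom b a, ccomp g f = cid a /\ ccomp f g = cid b.

Definition isomorphic (C : category) (a b : C) : Prop :=
  exists f : chom a b, is_iso f.

Record functor (C D : category) := Functor {
  fun_ob :> C -> D;
  fun_hom : forall a b, chom a b -> chom (fun_ob a) (fun_ob b);
  fun_id : forall a, fun_hom (cid a) = cid (fun_ob a);
  fun_comp : forall a b c (g : chom b c) (f : chom a b),
    fun_hom (ccomp g f) = ccomp (fun_hom g) (fun_hom f)
}.
Arguments fun_hom {C D} F {a b} f : rename.

(* An adjunction with left adjoint F and right adjoint G, given by a unit
   Id -> G F and a counit F G -> Id satisfying the triangle identities. *)
Record adjunction (C D : category) (F : functor C D) (G : functor D C) :=
  Adjunction {
  adj_unit : forall c : C, chom c (G (F c));
  adj_counit : forall d : D, chom (F (G d)) d;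
  unit_nat : forall (c c' : C) (f : chom c c'),
    ccomp (fun_hom G (fun_hom F f)) (adj_unit c) = ccomp (adj_unit c') f;
  counit_nat : forall (d d' : D) (g : chom d d'),
    ccomp g (adj_counit d) = ccomp (adj_counit d') (fun_hom F (fun_hom G g));
  triangleL : forall c : C, ccomp (adj_counit (F c)) (fun_hom F (adj_unit c)) = cid (F c);
  triangleR : forall d : D, ccomp (fun_hom G (adj_counit d)) (adj_unit (G d)) = cid (G d)
}.
Arguments adj_unit {C D F G} A c : rename.
Arguments adj_counit {C D F G} A d : rename.

Definition is_adjoint_equivalence (C D : category) (F : functor C D)
    (G : functor D C) (A : adjunction F G) : Prop :=
  (forall c : C, is_iso (adj_unit A c)) /\ (forall d : D, is_iso (adj_counit A d)).

Definition full_subcategory (C : category) (S : C -> Prop) : category :=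
  @Category {c : C | S c}
    (fun a b => chom (sval a) (sval b))
    (fun a => cid (sval a))
    (fun _ _ _ g f => ccomp g f)
    (fun _ _ _ _ h g f => ccompA h g f)
    (fun _ _ f => ccomp1f f)
    (fun _ _ f => ccompf1 f).

Definition restrict_functor (C D : category) (F : functor C D)
    (S : C -> Prop) (T : D -> Prop) (FST : forall c, S c -> T (F c)) :
    functor (full_subcategory S) (full_subcategory T) :=
  @Functor (full_subcategory S) (full_subcategory T)
    (fun a => exist T (F (sval a)) (FST (sval a) (svalP a)))
    (fun _ _ f => fun_hom F f)
    (fun a => fun_id F (sval a))
    (fun _ _ _ g f => fun_comp F g f).

Arguments restrict_functor {C D} F {S T} FST.

(* The unit and counit of the restricted adjunction are those of A. *)
Definition restricts_to_adjoint_equivalence (C D : category) (F : functor C D)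
    (G : functor D C) (A : adjunction F G) (S : C -> Prop) (T : D -> Prop) :
    Prop :=
  exists (FST : forall c, S c -> T (F c)) (GTS : forall d, T d -> S (G d))
    (B : adjunction (restrict_functor F FST) (restrict_functor G GTS)),
    [/\ forall c : full_subcategory S, adj_unit B c = adj_unit A (sval c),
        forall d : full_subcategory T, adj_counit B d = adj_counit A (sval d)
      & is_adjoint_equivalence B].

(* Possibly non-unital rings with x * x = x; commutativity and x + x = 0
   are consequences. *)
HB.mixin Record Zmodule_isBooleanRing R of GRing.Zmodule R := {
  bmul : R -> R -> R;
  bmulA : associative bmul;
  bmulDl : left_distributive bmul +%R;
  bmulDr : right_distributive bmul +%R;
  bmulxx : idempotent_op bmul
}.

#[short(type="booleanRingType")]
HB.structure Definition BooleanRing :=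
  {R of Zmodule_isBooleanRing R & GRing.Zmodule R}.

Reserved Notation "x *b y" (at level 40, left associativity).
Reserved Notation "x \subseteqb y" (at level 70).
Notation "x *b y" := (bmul x y) : ring_scope.
Notation "x \subseteqb y" := (bmul x y = x) : ring_scope.

Definition br_morphism (R S : booleanRingType) (f : R -> S) : Prop :=
  {morph f : x y / x + y} /\ {morph f : x y / x *b y}.

(* [garr a b] is the set of morphisms from b to a, so that composites
   [gmul g h] read in the order in which they are written. *)
Record groupoid := Groupoid {
  gob :> Type;
  garr : gob -> gob -> Type;
  gone : forall a, garr a a;
  gmul : forall a b c, garr a b -> garr b c -> garr a c;
  ginv : forall a b, garr a b -> garr b a;
  gmulA : forall a b c d (x : garr a b) (y : garr b c) (z : garr c d),
    gmul x (gmul y z) = gmul (gmul x y) z;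
  gmul1g : forall a b (x : garr a b), gmul (gone a) x = x;
  gmulg1 : forall a b (x : garr a b), gmul x (gone b) = x;
  gmulVg : forall a b (x : garr a b), gmul (ginv x) x = gone b;
  gmulgV : forall a b (x : garr a b), gmul x (ginv x) = gone a
}.

(* All morphisms with codomain a. *)
Definition gstar (G : groupoid) (a : G) : Type := {b : G & garr a b}.

Record groupoid_hom (G H : groupoid) := GroupoidHom {
  gh_ob :> G -> H;
  gh_arr : forall a b, garr a b -> garr (gh_ob a) (gh_ob b);
  gh_one : forall a, gh_arr (gone a) = gone (gh_ob a);
  gh_mul : forall a b c (x : garr a b) (y : garr b c),
    gh_arr (gmul x y) = gmul (gh_arr x) (gh_arr y)
}.
Arguments gh_arr {G H} f {a b} x : rename.

Definition gh_star (G H : groupoid) (f : groupoid_hom G H) (a : G)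
    (x : gstar a) : gstar (f a) :=
  existT _ (f (tag x)) (gh_arr f (tagged x)).

Lemma groupoid_hom_eq (G H : groupoid) (f g : groupoid_hom G H)
    (e : gh_ob f = gh_ob g) :
  (forall a b (x : garr a b),
     eq_rect _ (fun o : G -> H => garr (o a) (o b)) (gh_arr f x) _ e
     = gh_arr g x) -> f = g.
Proof.
case: f g e => [fo fa f1 fM] [g_o ga g1 gM] /= e; subst g_o => /= E.
have {}E : fa = ga.
  apply: functional_extensionality_dep => a.
  by apply: functional_extensionality_dep => b; apply: funext => x; exact: E.
subst ga; by rewrite (Prop_irrelevance f1 g1) (Prop_irrelevance fM gM).
Qed.

Definition gh_id (G : groupoid) : groupoid_hom G G :=
  @GroupoidHom G G (fun a => a) (fun _ _ x => x)
    (fun _ => erefl) (fun _ _ _ _ _ => erefl).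

Program Definition gh_comp (G H K : groupoid) (g : groupoid_hom H K)
    (f : groupoid_hom G H) : groupoid_hom G K :=
  @GroupoidHom G K (fun a => g (f a)) (fun _ _ x => gh_arr g (gh_arr f x)) _ _.
Next Obligation. by move=> G H K g f a /=; rewrite !gh_one. Qed.
Next Obligation. by move=> G H K g f a b c x y /=; rewrite !gh_mul. Qed.

Record groupoid_preorder := GroupoidPreorder {
  gp_gpd :> groupoid;
  gle : forall a : gp_gpd, gstar a -> gstar a -> Prop;
  gle_preorder : forall a : gp_gpd, PreOrder (@gle a)
}.

Record gp_hom (G H : groupoid_preorder) := GpHom {
  gp_gh :> groupoid_hom G H;
  gp_mono : forall (a : G) (x y : gstar a),
    gle x y -> gle (gh_star gp_gh x) (gh_star gp_gh y)
}.

Lemma gp_hom_eq (G H : groupoid_preorder) (f g : gp_hom G H) :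
  gp_gh f = gp_gh g -> f = g.
Proof.
by case: f g => [f fm] [g gm] /= e; subst g; rewrite (Prop_irrelevance fm gm).
Qed.

Lemma gh_star_id (G : groupoid) (a : G) (x : gstar a) : gh_star (gh_id G) x = x.
Proof. by case: x. Qed.

Program Definition gp_id (G : groupoid_preorder) : gp_hom G G :=
  @GpHom G G (gh_id G) _.
Next Obligation. by move=> G a x y; rewrite !gh_star_id. Qed.

Definition gp_comp (G H K : groupoid_preorder) (g : gp_hom H K)
    (f : gp_hom G H) : gp_hom G K :=
  @GpHom G K (gh_comp g f) (fun _ _ _ le => gp_mono g (gp_mono f le)).

Program Definition GpdPreOrd : category :=
  @Category groupoid_preorder gp_hom gp_id gp_comp _ _ _.
Next Obligation.
by move=> *; apply: gp_hom_eq; unshelve eapply groupoid_hom_eq.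
Qed.
Next Obligation.
by move=> *; apply: gp_hom_eq; unshelve eapply groupoid_hom_eq.
Qed.
Next Obligation.
by move=> *; apply: gp_hom_eq; unshelve eapply groupoid_hom_eq.
Qed.

(* Functors from a groupoid to Boolean rings. *)
Record br_functor (G : groupoid) := BrFunctor {
  bf_ob :> G -> booleanRingType;
  bf_arr : forall a b, garr a b -> bf_ob b -> bf_ob a;
  bf_morph : forall a b (g : garr a b), br_morphism (bf_arr g);
  bf_one : forall a (x : bf_ob a), bf_arr (gone a) x = x;
  bf_mul : forall a b c (g : garr a b) (h : garr b c) (x : bf_ob c),
    bf_arr (gmul g h) x = bf_arr g (bf_arr h x)
}.
Arguments bf_arr {G} L {a b} g x : rename.

Program Definition bf_comp (G H : groupoid) (L : br_functor H)
    (f : groupoid_hom G H) : br_functor G :=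
  @BrFunctor G (fun a => L (f a)) (fun _ _ g => bf_arr L (gh_arr f g)) _ _ _.
Next Obligation. by move=> *; exact: bf_morph. Qed.
Next Obligation. by move=> * /=; rewrite gh_one bf_one. Qed.
Next Obligation. by move=> * /=; rewrite gh_mul bf_mul. Qed.

Record br_nat (G : groupoid) (L M : br_functor G) := BrNat {
  bn_app :> forall a, L a -> M a;
  bn_morph : forall a, br_morphism (@bn_app a);
  bn_nat : forall a b (g : garr a b) (x : L b),
    bn_app (bf_arr L g x) = bf_arr M g (bn_app x)
}.

Record protorootoid := Protorootoid {
  pr_gpd :> groupoid;
  pr_ring : br_functor pr_gpd;
  pr_cocycle : forall a b : pr_gpd, garr a b -> pr_ring a;
  pr_cocycleM : forall (a b c : pr_gpd) (g : garr a b) (h : garr b c),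
    pr_cocycle (gmul g h) = pr_cocycle g + bf_arr pr_ring g (pr_cocycle h)
}.
Arguments pr_cocycle R {a b} g : rename.

Record pr_hom (R S : protorootoid) := PrHom {
  pr_gh : groupoid_hom R S;
  pr_nat : br_nat (pr_ring R) (bf_comp (pr_ring S) pr_gh);
  pr_homN : forall (a b : R) (g : garr a b),
    pr_nat a (pr_cocycle R g) = pr_cocycle S (gh_arr pr_gh g)
}.

Lemma pr_hom_eq (R S : protorootoid) (f g : pr_hom R S)
    (e : gh_ob (pr_gh f) = gh_ob (pr_gh g)) :
  (forall a b (x : garr a b),
     eq_rect _ (fun o : R -> S => garr (o a) (o b)) (gh_arr (pr_gh f) x) _ e
     = gh_arr (pr_gh g) x) ->
  (forall a (x : pr_ring R a),
     eq_rect _ (fun o : R -> S => pr_ring S (o a)) (pr_nat f a x) _ e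
     = pr_nat g a x) ->
  f = g.
Proof.
case: f g e => [f nf Nf] [g ng Ng] /= e E1.
have E := groupoid_hom_eq E1; subst g.
rewrite (Prop_irrelevance e erefl) /= => {e E1}.
case: nf ng Nf Ng => [nf mf natf] [ng mg natg] /= Nf Ng E.
have {}E : nf = ng.
  by apply: functional_extensionality_dep => a; apply: funext => x; exact: E.
subst ng.
rewrite (Prop_irrelevance mf mg) in Nf *.
rewrite (Prop_irrelevance natf natg) in Nf *.
by rewrite (Prop_irrelevance Nf Ng).
Qed.

Program Definition pr_id (R : protorootoid) : pr_hom R R :=
  @PrHom R R (gh_id R)
    (@BrNat R (pr_ring R) (bf_comp (pr_ring R) (gh_id R)) (fun _ x => x) _ _) _.
Next Obligation. by []. Qed.
Next Obligation. by []. Qed.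
Next Obligation. by []. Qed.

Lemma br_morphism_comp (R S T : booleanRingType) (g : S -> T) (f : R -> S) :
  br_morphism g -> br_morphism f -> br_morphism (g \o f).
Proof. by move=> [gD gM] [fD fM]; split=> x y /=; rewrite ?fD ?fM ?gD ?gM. Qed.

Program Definition pr_comp (R S T : protorootoid) (g : pr_hom S T)
    (f : pr_hom R S) : pr_hom R T :=
  @PrHom R T (gh_comp (pr_gh g) (pr_gh f))
    (@BrNat R (pr_ring R) (bf_comp (pr_ring T) (gh_comp (pr_gh g) (pr_gh f)))
      (fun a x => pr_nat g (pr_gh f a) (pr_nat f a x)) _ _) _.
Next Obligation.
move=> R S T g f a.
exact: br_morphism_comp (bn_morph (pr_nat g) _) (bn_morph (pr_nat f) _).
Qed.
Next Obligation.
move=> R S T g f a b h x /=.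
by rewrite (bn_nat (pr_nat f)) /= (bn_nat (pr_nat g)).
Qed.
Next Obligation. by move=> R S T g f a b h /=; rewrite !pr_homN. Qed.

Program Definition Prd : category :=
  @Category protorootoid pr_hom pr_id pr_comp _ _ _.
Next Obligation. by move=> *; unshelve eapply pr_hom_eq. Qed.
Next Obligation. by move=> *; unshelve eapply pr_hom_eq. Qed.
Next Obligation. by move=> *; unshelve eapply pr_hom_eq. Qed.

Definition weak_right_le (R : protorootoid) (a : R) (x y : gstar a) : Prop :=
  pr_cocycle R (tagged x) \subseteqb pr_cocycle R (tagged y).

Lemma weak_right_preorder (R : protorootoid) (a : R) :
  PreOrder (@weak_right_le R a).
Proof.
split=> [x|x y z]; rewrite /weak_right_le; first exact: bmulxx.
by move=> xy yz; rewrite -{1}xy -bmulA yz.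
Qed.

Definition weak_right (R : protorootoid) : groupoid_preorder :=
  @GroupoidPreorder R (@weak_right_le R) (@weak_right_preorder R).

Program Definition weak_right_hom (R S : protorootoid) (f : pr_hom R S) :
    gp_hom (weak_right R) (weak_right S) :=
  @GpHom (weak_right R) (weak_right S) (pr_gh f) _.
Next Obligation.
move=> R S f a [b x] [c y]; rewrite /= /weak_right_le /=.
by rewrite -!(pr_homN f); have [_ <-] := bn_morph (pr_nat f) a => ->.
Qed.

Program Definition P_functor : functor Prd GpdPreOrd :=
  @Functor Prd GpdPreOrd weak_right weak_right_hom _ _.
Next Obligation. by move=> R; apply: gp_hom_eq. Qed.
Next Obligation. by move=> *; apply: gp_hom_eq. Qed.

(* Objects of Gpd-PreOrd_P: equality with some P(R), not just isomorphism. *)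
Definition inGpdPreOrdP (a : GpdPreOrd) : Prop :=
  exists R : Prd, P_functor R = a.

(* Objects of Prd_F. *)
Definition inPrdF (Q : functor GpdPreOrd Prd) (A : adjunction Q P_functor)
    (R : Prd) : Prop :=
  is_iso (adj_counit A R).

(* The left adjoint of [P_functor] is unique up to isomorphism. The rest of the
   file realizes it by generators and relations ([Q_functor]), with a unit that
   is the identity on underlying groupoids ([Q_unit]), and proves the
   adjunction ([Q_P_adjunction]). *)

Inductive bterm (X : Type) : Type :=
| BGen of X
| BZero
| BAdd of bterm X & bterm X
| BMul of bterm X & bterm X.
Arguments BZero {X}.

(* The congruence generated by the axioms of Boolean rings and by r = 0 for
   all relators r. As x + x = 0, no symbol for the opposite is needed. *)
Inductive beq (X : Type) (rel : bterm X -> Prop) : bterm X -> bterm X -> Prop :=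
| beq_rel r : rel r -> beq rel r BZero
| beq_refl s : beq rel s s
| beq_sym s t : beq rel s t -> beq rel t s
| beq_trans s t u : beq rel s t -> beq rel t u -> beq rel s u
| beq_add s s' t t' : beq rel s s' -> beq rel t t' ->
    beq rel (BAdd s t) (BAdd s' t')
| beq_mul s s' t t' : beq rel s s' -> beq rel t t' ->
    beq rel (BMul s t) (BMul s' t')
| beq_addA s t u : beq rel (BAdd s (BAdd t u)) (BAdd (BAdd s t) u)
| beq_addC s t : beq rel (BAdd s t) (BAdd t s)
| beq_add0 s : beq rel (BAdd BZero s) s
| beq_addss s : beq rel (BAdd s s) BZero
| beq_mulA s t u : beq rel (BMul s (BMul t u)) (BMul (BMul s t) u)
| beq_mulDl s t u : beq rel (BMul (BAdd s t) u) (BAdd (BMul s u) (BMul t u))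
| beq_mulDr s t u : beq rel (BMul s (BAdd t u)) (BAdd (BMul s t) (BMul s u))
| beq_mulss s : beq rel (BMul s s) s.

HB.instance Definition _ (X : Type) := gen_eqMixin (bterm X).
HB.instance Definition _ (X : Type) := gen_choiceMixin (bterm X).

Section Presentation.
Local Open Scope quotient_scope.
Variables (X : Type) (rel : bterm X -> Prop).

Definition beqb (s t : bterm X) : bool := `[< beq rel s t >].

Lemma beqb_refl : reflexive beqb.
Proof. by move=> s; apply/asboolP; exact: beq_refl. Qed.

Lemma beqb_sym : symmetric beqb.
Proof. by move=> s t; apply/asboolP/asboolP; exact: beq_sym. Qed.

Lemma beqb_trans : transitive beqb.
Proof.
by move=> t s u /asboolP st /asboolP tu; apply/asboolP; exact: beq_trans st tu.
Qed.

Canonical beqb_equiv := EquivRel beqb beqb_refl beqb_sym beqb_trans.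

Definition presented := {eq_quot beqb_equiv}.
HB.instance Definition _ := Choice.on presented.

Definition bclass (s : bterm X) : presented := \pi_(presented) s.

Lemma bclassP (s t : bterm X) : bclass s = bclass t <-> beq rel s t.
Proof.
split=> [/eqmodP /asboolP //|st].
by apply/eqmodP; apply/asboolP.
Qed.

Lemma bclass_surj (q : presented) : exists s, q = bclass s.
Proof. by exists (repr q); rewrite /bclass reprK. Qed.

Lemma beq_repr (s : bterm X) : beq rel (repr (bclass s)) s.
Proof. by apply/bclassP; rewrite /bclass reprK. Qed.

Definition padd (p q : presented) : presented := bclass (BAdd (repr p) (repr q)).
Definition pmul (p q : presented) : presented := bclass (BMul (repr p) (repr q)).

Lemma paddE s t : padd (bclass s) (bclass t) = bclass (BAdd s t).
Proof. by apply/bclassP; apply: beq_add; exact: beq_repr. Qed.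

Lemma pmulE s t : pmul (bclass s) (bclass t) = bclass (BMul s t).
Proof. by apply/bclassP; apply: beq_mul; exact: beq_repr. Qed.

Lemma paddA : associative padd.
Proof.
move=> p q r; have [s ->] := bclass_surj p; have [t ->] := bclass_surj q.
have [u ->] := bclass_surj r; rewrite !paddE; apply/bclassP; exact: beq_addA.
Qed.

Lemma paddC : commutative padd.
Proof.
move=> p q; have [s ->] := bclass_surj p; have [t ->] := bclass_surj q.
by rewrite !paddE; apply/bclassP; exact: beq_addC.
Qed.

Lemma padd0 : left_id (bclass BZero) padd.
Proof.
move=> p; have [s ->] := bclass_surj p; rewrite paddE; apply/bclassP.
exact: beq_add0.
Qed.

Lemma paddN : left_inverse (bclass BZero) id padd.
Proof.
move=> p; have [s ->] := bclass_surj p; rewrite paddE; apply/bclassP.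
exact: beq_addss.
Qed.

HB.instance Definition _ :=
  GRing.isZmodule.Build presented paddA paddC padd0 paddN.

Lemma pmulA : associative pmul.
Proof.
move=> p q r; have [s ->] := bclass_surj p; have [t ->] := bclass_surj q.
have [u ->] := bclass_surj r; rewrite !pmulE; apply/bclassP; exact: beq_mulA.
Qed.

Lemma pmulDl : left_distributive pmul (@GRing.add presented).
Proof.
move=> p q r; have [s ->] := bclass_surj p; have [t ->] := bclass_surj q.
have [u ->] := bclass_surj r.
by rewrite [_ + _]paddE !pmulE [RHS]paddE; apply/bclassP; exact: beq_mulDl.
Qed.

Lemma pmulDr : right_distributive pmul (@GRing.add presented).
Proof.
move=> p q r; have [s ->] := bclass_surj p; have [t ->] := bclass_surj q.
have [u ->] := bclass_surj r.
by rewrite [X in pmul _ X]paddE !pmulE [RHS]paddE; apply/bclassP; exact: beq_mulDr.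
Qed.

Lemma pmulxx : idempotent_op pmul.
Proof.
move=> p; have [s ->] := bclass_surj p; rewrite pmulE; apply/bclassP.
exact: beq_mulss.
Qed.

HB.instance Definition _ :=
  Zmodule_isBooleanRing.Build presented pmulA pmulDl pmulDr pmulxx.

Definition bgen (x : X) : presented := bclass (BGen x).

Section Lift.
Variables (S : booleanRingType) (f : X -> S).

Fixpoint beval (s : bterm X) : S :=
  match s with
  | BGen x => f x
  | BZero => 0
  | BAdd s t => beval s + beval t
  | BMul s t => beval s *b beval t
  end.

Lemma br_addxx (x : S) : x + x = 0.
Proof.
have := bmulxx (x + x); rewrite bmulDl !bmulDr !bmulxx => /eqP.
by rewrite -subr_eq0 addrK => /eqP.
Qed.

Hypothesis f_rel : forall r, rel r -> beval r = 0.

Lemma beval_beq s t : beq rel s t -> beval s = beval t.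
Proof.
elim=> {s t} //=.
- by move=> s t u _ -> _ ->.
- by move=> s s' t t' _ -> _ ->.
- by move=> s s' t t' _ -> _ ->.
- by move=> *; rewrite addrA.
- by move=> *; rewrite addrC.
- by move=> *; rewrite add0r.
- by move=> *; rewrite br_addxx.
- by move=> *; rewrite bmulA.
- by move=> *; rewrite bmulDl.
- by move=> *; rewrite bmulDr.
- by move=> *; rewrite bmulxx.
Qed.

Definition blift (p : presented) : S := beval (repr p).

Lemma bliftE s : blift (bclass s) = beval s.
Proof. by apply: beval_beq; exact: beq_repr. Qed.

Lemma blift_morph : br_morphism blift.
Proof.
split=> p q; have [s ->] := bclass_surj p; have [t ->] := bclass_surj q.
  by rewrite [_ + _]paddE !bliftE.
by rewrite [_ *b _]pmulE !bliftE.
Qed.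

Lemma blift_gen x : blift (bgen x) = f x.
Proof. exact: bliftE. Qed.

End Lift.

Lemma br_morphism0 (R S : booleanRingType) (g : R -> S) :
  br_morphism g -> g 0 = 0.
Proof. by move=> [gD _]; apply: (addIr (g 0)); rewrite -gD !add0r. Qed.

Lemma presented_ext (S : booleanRingType) (g h : presented -> S) :
  br_morphism g -> br_morphism h -> (forall x, g (bgen x) = h (bgen x)) ->
  g =1 h.
Proof.
move=> mg mh gh p; have [s ->] := bclass_surj p.
elim: s => [x||s IHs t IHt|s IHs t IHt]; first exact: gh.
- by rewrite (br_morphism0 mg) (br_morphism0 mh).
- by rewrite -paddE mg.1 mh.1 IHs IHt.
- by rewrite -pmulE mg.2 mh.2 IHs IHt.
Qed.

End Presentation.

Section FreeProtorootoid.
Variable G : groupoid_preorder.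

(* (x, y) at b stands for the symbol (a, x, y), with y a morphism into b. *)
Definition qgen (a : G) : Type := {b : G & (garr a b * gstar b)%type}.
Definition mk_qgen (a b c : G) (x : garr a b) (y : garr b c) : qgen a :=
  existT _ b (x, existT _ c y).

Inductive qrel (a : G) : bterm (qgen a) -> Prop :=
| qrel_mul (b c d : G) (x : garr a b) (y : garr b c) (z : garr c d) :
    qrel (BAdd (BAdd (BGen (mk_qgen x (gmul y z))) (BGen (mk_qgen x y)))
               (BGen (mk_qgen (gmul x y) z)))
| qrel_le (b c d : G) (x : garr a b) (y : garr b c) (z : garr b d) :
    gle (existT _ c y) (existT _ d z) ->
    qrel (BAdd (BMul (BGen (mk_qgen x y)) (BGen (mk_qgen x z)))
               (BGen (mk_qgen x y))).

Definition qring (a : G) : booleanRingType := presented (@qrel a).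

Definition qsym (a b c : G) (x : garr a b) (y : garr b c) : qring a :=
  bgen (@qrel a) (mk_qgen x y).

Lemma qsym_mul (a b c d : G) (x : garr a b) (y : garr b c) (z : garr c d) :
  qsym x (gmul y z) + qsym x y + qsym (gmul x y) z = 0.
Proof.
rewrite [X in X + _]paddE [LHS]paddE; apply/bclassP; apply: beq_rel.
exact: qrel_mul.
Qed.

Lemma qsym_le (a b c d : G) (x : garr a b) (y : garr b c) (z : garr b d) :
  gle (existT _ c y) (existT _ d z) -> qsym x y *b qsym x z + qsym x y = 0.
Proof.
move=> yz; rewrite [X in X + _]pmulE [LHS]paddE; apply/bclassP; apply: beq_rel.
exact: qrel_le.
Qed.

Section QringLift.
Variables (a : G) (S : booleanRingType).
Variable f : forall b c : G, garr a b -> garr b c -> S.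

Definition qfun (u : qgen a) : S := f (tagged u).1 (tagged (tagged u).2).

Definition qlift : qring a -> S := blift qfun.

Hypothesis f_mul : forall (b c d : G) (x : garr a b) (y : garr b c) (z : garr c d),
  f x (gmul y z) + f x y + f (gmul x y) z = 0.
Hypothesis f_le : forall (b c d : G) (x : garr a b) (y : garr b c) (z : garr b d),
  gle (existT _ c y) (existT _ d z) -> f x y *b f x z + f x y = 0.

Lemma qfun_rel r : qrel r -> beval qfun r = 0.
Proof. by case=> [b c d x y z|b c d x y z] /=; [exact: f_mul | exact: f_le]. Qed.

Lemma qlift_morph : br_morphism qlift.
Proof. exact: blift_morph qfun_rel. Qed.

Lemma qlift_sym (b c : G) (x : garr a b) (y : garr b c) :
  qlift (qsym x y) = f x y.
Proof. exact: (blift_gen qfun_rel). Qed.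

End QringLift.

Lemma qring_ext (a : G) (S : booleanRingType) (g h : qring a -> S) :
  br_morphism g -> br_morphism h ->
  (forall (b c : G) (x : garr a b) (y : garr b c), g (qsym x y) = h (qsym x y)) ->
  g =1 h.
Proof. by move=> mg mh gh; apply: presented_ext => // -[b [x [c y]]]; apply: gh. Qed.

Definition qarr (a b : G) (g : garr a b) : qring b -> qring a :=
  qlift (fun _ _ x y => qsym (gmul g x) y).

Lemma qarr_morph (a b : G) (g : garr a b) : br_morphism (qarr g).
Proof.
apply: qlift_morph => *; last exact: qsym_le.
by rewrite gmulA qsym_mul.
Qed.

Lemma qarr_sym (a b c d : G) (g : garr a b) (x : garr b c) (y : garr c d) :
  qarr g (qsym x y) = qsym (gmul g x) y.
Proof.
apply: (@qlift_sym _ _ (fun _ _ x y => qsym (gmul g x) y)) => *.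
  by rewrite gmulA qsym_mul.
exact: qsym_le.
Qed.

Lemma br_morphism_id (R : booleanRingType) : br_morphism (fun x : R => x).
Proof. by []. Qed.

Program Definition qfunctor : br_functor G := @BrFunctor G qring qarr qarr_morph _ _.
Next Obligation.
move=> a; apply: qring_ext => [||b c x y]; first exact: qarr_morph.
  exact: br_morphism_id.
by rewrite qarr_sym gmul1g.
Qed.
Next Obligation.
move=> a b c g h; apply: qring_ext => [||d e x y]; first exact: qarr_morph.
  exact: (br_morphism_comp (qarr_morph g) (qarr_morph h)).
by rewrite !qarr_sym gmulA.
Qed.

Program Definition Q_ob : protorootoid :=
  @Protorootoid G qfunctor (fun a b g => qsym (gone a) g) _.
Next Obligation.
move=> a b c g h /=; rewrite qarr_sym gmulg1.
have := qsym_mul (gone a) g h; rewrite gmul1g -addrA => /eqP.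
rewrite addr_eq0 => /eqP ->.
by apply/eqP; rewrite eq_sym -addr_eq0 br_addxx.
Qed.

End FreeProtorootoid.

Section FreeMorphism.
Variables (G H : groupoid_preorder) (f : gp_hom G H).

Definition qmap (a : G) : qring a -> qring (f a) :=
  qlift (fun _ _ x y => qsym (gh_arr f x) (gh_arr f y)).

Lemma qmap_mul (a b c d : G) (x : garr a b) (y : garr b c) (z : garr c d) :
  qsym (gh_arr f x) (gh_arr f (gmul y z)) + qsym (gh_arr f x) (gh_arr f y)
  + qsym (gh_arr f (gmul x y)) (gh_arr f z) = 0.
Proof. by rewrite !gh_mul qsym_mul. Qed.

Lemma qmap_le (a b c d : G) (x : garr a b) (y : garr b c) (z : garr b d) :
  gle (existT _ c y) (existT _ d z) ->
  qsym (gh_arr f x) (gh_arr f y) *b qsym (gh_arr f x) (gh_arr f z)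
  + qsym (gh_arr f x) (gh_arr f y) = 0.
Proof. by move=> yz; apply: qsym_le; exact: (gp_mono f yz). Qed.

Lemma qmap_morph (a : G) : br_morphism (@qmap a).
Proof. exact: qlift_morph (@qmap_mul a) (@qmap_le a). Qed.

Lemma qmap_sym (a b c : G) (x : garr a b) (y : garr b c) :
  qmap (qsym x y) = qsym (gh_arr f x) (gh_arr f y).
Proof. exact: (qlift_sym (@qmap_mul a) (@qmap_le a)). Qed.

Lemma qmap_nat (a b : G) (g : garr a b) (x : qring b) :
  qmap (qarr g x) = qarr (gh_arr f g) (qmap x).
Proof.
move: x; apply: qring_ext => [||c d x y].
- exact: (br_morphism_comp (@qmap_morph _) (qarr_morph g)).
- exact: (br_morphism_comp (qarr_morph _) (@qmap_morph _)).
- by rewrite qarr_sym !qmap_sym qarr_sym gh_mul.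
Qed.

Program Definition Q_hom : pr_hom (Q_ob G) (Q_ob H) :=
  @PrHom (Q_ob G) (Q_ob H) f
    (@BrNat G (qfunctor G) (bf_comp (qfunctor H) f) qmap qmap_morph qmap_nat) _.
Next Obligation. by move=> a b g /=; rewrite qmap_sym gh_one. Qed.

End FreeMorphism.

Program Definition Q_functor : functor GpdPreOrd Prd :=
  @Functor GpdPreOrd Prd Q_ob Q_hom _ _.
Next Obligation.
move=> G; unshelve eapply pr_hom_eq => //= a.
apply: qring_ext => [||b c x y]; first exact: (@qmap_morph _ _ (gp_id G)).
  exact: br_morphism_id.
by rewrite (@qmap_sym _ _ (gp_id G)).
Qed.
Next Obligation.
move=> G H K g f; unshelve eapply pr_hom_eq => //= a.
apply: qring_ext => [||b c x y]; first exact: (@qmap_morph _ _ (gp_comp g f)).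
  exact: (br_morphism_comp (@qmap_morph _ _ g _) (@qmap_morph _ _ f _)).
by rewrite (@qmap_sym _ _ (gp_comp g f)) !qmap_sym.
Qed.

Program Definition Q_unit (G : groupoid_preorder) : gp_hom G (weak_right (Q_ob G)) :=
  @GpHom G (weak_right (Q_ob G)) (gh_id G) _.
Next Obligation.
move=> G a [b x] [c y] xy; rewrite /= /weak_right_le /=.
by have /eqP := qsym_le (gone a) xy; rewrite addr_eq0 => /eqP ->;
  apply/eqP; rewrite eq_sym -addr_eq0 br_addxx.
Qed.

Section Counit.
Variable R : protorootoid.

Definition qeps (a : R) : @qring (weak_right R) a -> pr_ring R a :=
  @qlift (weak_right R) a _ (fun _ _ x y => bf_arr (pr_ring R) x (pr_cocycle R y)).

Lemma qeps_mul (a b c d : R) (x : garr a b) (y : garr b c) (z : garr c d) :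
  bf_arr (pr_ring R) x (pr_cocycle R (gmul y z))
  + bf_arr (pr_ring R) x (pr_cocycle R y)
  + bf_arr (pr_ring R) (gmul x y) (pr_cocycle R z) = 0.
Proof.
by rewrite pr_cocycleM (bf_morph _ x).1 bf_mul -addrA br_addxx.
Qed.

Lemma qeps_le (a b c d : weak_right R) (x : garr a b) (y : garr b c) (z : garr b d) :
  gle (existT _ c y) (existT _ d z) ->
  bf_arr (pr_ring R) x (pr_cocycle R y) *b bf_arr (pr_ring R) x (pr_cocycle R z)
  + bf_arr (pr_ring R) x (pr_cocycle R y) = 0.
Proof.
by rewrite /= /weak_right_le /= -(bf_morph _ x).2 => ->; exact: br_addxx.
Qed.

Lemma qeps_morph (a : R) : br_morphism (@qeps a).
Proof. exact: (qlift_morph (G := weak_right R) (@qeps_mul a) (@qeps_le a)). Qed.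

Lemma qeps_sym (a b c : R) (x : garr a b) (y : garr b c) :
  qeps (@qsym (weak_right R) _ _ _ x y) = bf_arr (pr_ring R) x (pr_cocycle R y).
Proof. exact: (qlift_sym (G := weak_right R) (@qeps_mul a) (@qeps_le a)). Qed.

Lemma qeps_nat (a b : R) (g : garr a b) (x : @qring (weak_right R) b) :
  qeps (@qarr (weak_right R) _ _ g x) = bf_arr (pr_ring R) g (qeps x).
Proof.
move: x; apply: qring_ext => [||c d x y].
- exact: (br_morphism_comp (@qeps_morph _) (@qarr_morph (weak_right R) _ _ g)).
- exact: (br_morphism_comp (bf_morph _ _) (@qeps_morph _)).
- by rewrite qarr_sym !qeps_sym bf_mul.
Qed.

Program Definition Q_counit : pr_hom (Q_ob (weak_right R)) R :=
  @PrHom (Q_ob (weak_right R)) R (gh_id R)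
    (@BrNat R (qfunctor (weak_right R)) (bf_comp (pr_ring R) (gh_id R))
      qeps qeps_morph qeps_nat) _.
Next Obligation. by move=> a b g /=; rewrite qeps_sym bf_one. Qed.

End Counit.

Program Definition Q_P_adjunction : adjunction Q_functor P_functor :=
  @Adjunction GpdPreOrd Prd Q_functor P_functor Q_unit Q_counit _ _ _ _.
Next Obligation.
by move=> *; apply: gp_hom_eq; unshelve eapply groupoid_hom_eq.
Qed.
Next Obligation.
move=> R S f; unshelve eapply pr_hom_eq => //= a.
apply: qring_ext => [||b c x y].
- exact: (br_morphism_comp (bn_morph (pr_nat f) _) (@qeps_morph R _)).
- exact: (br_morphism_comp (@qeps_morph S _)
           (@qmap_morph _ _ (weak_right_hom f) _)).
- rewrite qeps_sym (@qmap_sym _ _ (weak_right_hom f)) qeps_sym.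
  by rewrite (bn_nat (pr_nat f)) pr_homN.
Qed.
Next Obligation.
move=> G; unshelve eapply pr_hom_eq => //= a.
apply: qring_ext => [||b c x y].
- exact: (br_morphism_comp (@qeps_morph (Q_ob G) _) (@qmap_morph _ _ (Q_unit G) _)).
- exact: br_morphism_id.
- by rewrite (@qmap_sym _ _ (Q_unit G)) qeps_sym /= qarr_sym gmulg1.
Qed.
Next Obligation.
by move=> *; apply: gp_hom_eq; unshelve eapply groupoid_hom_eq.
Qed.

(* Main.v *)
(* The adjunction is idempotent. In the realization of the left adjoint by
   generators and relations, the unit is the identity of underlying groupoids;
   the triangle identity at [R] then makes the counit at [R] the identity of the
   groupoid as well, so that it is inverse to the unit at [P R]. A map which is
   the identity of groupoids is invertible only if the two preorders coincide,
   so an invertible unit at [a] gives an equality [P (Q a) = a] and not just an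
   isomorphism. Units of two left adjoints of [P] differ by an isomorphism, so
   this carries over to every left adjoint; the rest is formal. *)
From mathcomp Require Import boolp.
Require Import Defs.
From mathcomp Require Import all_boot.

Set Implicit Arguments.
Unset Strict Implicit.
Unset Printing Implicit Defensive.

Section Isomorphisms.
Variable C : category.

Lemma iso_id (a : C) : is_iso (cid a).
Proof. by exists (cid a); rewrite ccomp1f. Qed.

Lemma iso_comp (a b c : C) (g : chom b c) (f : chom a b) :
  is_iso g -> is_iso f -> is_iso (ccomp g f).
Proof.
move=> [g' [g'g gg']] [f' [f'f ff']]; exists (ccomp f' g'); split.
  by rewrite -ccompA (ccompA g') g'g ccomp1f.
by rewrite -ccompA (ccompA f) ff' ccomp1f.
Qed.

Lemma iso_cancel_r (a b c : C) (g : chom b c) (f : chom a b) :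
  is_iso f -> is_iso (ccomp g f) -> is_iso g.
Proof.
move=> [f' [f'f ff']] gf_iso.
have -> : g = ccomp (ccomp g f) f' by rewrite -ccompA ff' ccompf1.
by apply: iso_comp => //; exists f.
Qed.

Lemma iso_cancel_l (a b c : C) (g : chom b c) (f : chom a b) :
  is_iso g -> is_iso (ccomp g f) -> is_iso f.
Proof.
move=> [g' [g'g gg']] gf_iso.
have -> : f = ccomp g' (ccomp g f) by rewrite ccompA g'g ccomp1f.
by apply: iso_comp => //; exists g.
Qed.

Lemma isomorphic_sym (a b : C) : isomorphic a b -> isomorphic b a.
Proof. by move=> [f [g [gf fg]]]; exists g, f. Qed.

End Isomorphisms.

Lemma functor_iso (C D : category) (F : functor C D) (a b : C) (f : chom a b) :
  is_iso f -> is_iso (fun_hom F f).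
Proof.
by move=> [g [gf fg]]; exists (fun_hom F g); rewrite -!fun_comp gf fg !fun_id.
Qed.

Section Adjunctions.
Variables (C D : category) (F : functor C D) (G : functor D C).
Variable A : adjunction F G.

(** A map [h] out of [F c] is recovered from its transpose along the unit, by naturality of the
    counit and a triangle identity. *)
Lemma adj_unit_epi (c : C) (d : D) (f g : chom (F c) d) :
  ccomp (fun_hom G f) (adj_unit A c) = ccomp (fun_hom G g) (adj_unit A c) ->
  f = g.
Proof.
have transpose (h : chom (F c) d) :
    h = ccomp (adj_counit A d)
              (fun_hom F (ccomp (fun_hom G h) (adj_unit A c))).
  by rewrite fun_comp ccompA -counit_nat -ccompA triangleL ccompf1.
by move=> e; rewrite (transpose f) (transpose g) e.
Qed.

(** By a triangle identity, the counit at [F c] is a left inverse of the image under [F] of the unit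
    at [c]. *)
Lemma counit_iso_of_unit_iso (c : C) :
  is_iso (adj_unit A c) -> is_iso (adj_counit A (F c)).
Proof.
move=> eta_iso; apply: (iso_cancel_r (functor_iso F eta_iso)).
by rewrite triangleL; exact: iso_id.
Qed.

Lemma counit_iso_isomorphic (d d' : D) :
  isomorphic d d' -> is_iso (adj_counit A d) -> is_iso (adj_counit A d').
Proof.
move=> [f f_iso] eps_iso.
(* The other three sides of the naturality square of the counit at [f] are invertible. *)
apply: (iso_cancel_r (functor_iso F (functor_iso G f_iso))).
by rewrite -counit_nat; exact: iso_comp.
Qed.

Lemma restrict_adjoint_equivalence (S : C -> Prop) (T : D -> Prop) :
  (forall c, S c -> T (F c)) -> (forall d, T d -> S (G d)) ->
  (forall c, S c -> is_iso (adj_unit A c)) ->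
  (forall d, T d -> is_iso (adj_counit A d)) ->
  restricts_to_adjoint_equivalence A S T.
Proof.
move=> FST GTS eta_iso eps_iso; exists FST, GTS.
(* Fullness keeps the types of morphisms unchanged, so the laws of [A] apply verbatim. *)
unshelve eexists (@Adjunction (full_subcategory S) (full_subcategory T)
  (restrict_functor F FST) (restrict_functor G GTS)
  (fun c => adj_unit A (sval c)) (fun d => adj_counit A (sval d)) _ _ _ _).
- by move=> c c' f; exact: (unit_nat A).
- by move=> d d' g; exact: (counit_nat A).
- by move=> c; exact: (triangleL A).
- by move=> d; exact: (triangleR A).
split=> //; split=> [c|d].
  by have [g gK] := eta_iso _ (svalP c); exists g.
by have [g gK] := eps_iso _ (svalP d); exists g.
Qed.

End Adjunctions.

Section LeftAdjointUniqueness.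
Variables (C D : category) (G : functor D C).

(** The transpose under [A] of the unit of [A'], which compares two left adjoints of [G]. *)
Definition left_adjoint_map (F F' : functor C D) (A : adjunction F G)
    (A' : adjunction F' G) (c : C) : chom (F c) (F' c) :=
  ccomp (adj_counit A (F' c)) (fun_hom F (adj_unit A' c)).

Lemma left_adjoint_map_unit (F F' : functor C D) (A : adjunction F G)
    (A' : adjunction F' G) (c : C) :
  ccomp (fun_hom G (left_adjoint_map A A' c)) (adj_unit A c) = adj_unit A' c.
Proof.
by rewrite fun_comp -ccompA unit_nat ccompA triangleR ccomp1f.
Qed.

Lemma left_adjoint_mapK (F F' : functor C D) (A : adjunction F G)
    (A' : adjunction F' G) (c : C) :
  ccomp (left_adjoint_map A' A c) (left_adjoint_map A A' c) = cid (F c).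
Proof.
apply: (@adj_unit_epi _ _ _ _ A).
by rewrite fun_comp -ccompA !left_adjoint_map_unit fun_id ccomp1f.
Qed.

Lemma unit_iso_transfer (F F' : functor C D) (A : adjunction F G)
    (A' : adjunction F' G) (c : C) :
  is_iso (adj_unit A c) -> is_iso (adj_unit A' c).
Proof.
move=> eta_iso; rewrite -(left_adjoint_map_unit A A'); apply: iso_comp => //.
apply: functor_iso; exists (left_adjoint_map A' A c).
by split; exact: left_adjoint_mapK.
Qed.

End LeftAdjointUniqueness.

(** Along [e], both [f] and [g] are the identity of groupoids; the monotonicity of each gives one
    implication between the two preorders. *)
Lemma groupoid_preorder_eq (G H : groupoid_preorder)
    (f : gp_hom G H) (g : gp_hom H G) (e : gp_gpd G = gp_gpd H) :
  gp_gh f = eq_rect _ (groupoid_hom G) (gh_id G) _ e ->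
  gp_gh g = eq_rect _ (fun K => groupoid_hom K G) (gh_id G) _ e ->
  G = H.
Proof.
case: G H f g e => [G le leP] [H le' leP'] /= [f fm] [g gm] /= e.
subst H => /= ef eg; subst f g.
have E : le = le'.
  apply: functional_extensionality_dep => a.
  apply: funext => x; apply: funext => y; apply: propext.
  by split=> [/fm|/gm]; rewrite !gh_star_id.
by subst le'; rewrite (Prop_irrelevance leP leP').
Qed.

Lemma gh_comp_id (G H : groupoid) (f : groupoid_hom G H) :
  gh_comp f (gh_id G) = f.
Proof. by unshelve eapply groupoid_hom_eq. Qed.

Lemma Q_unit_iso_P (R : protorootoid) :
  is_iso (adj_unit Q_P_adjunction (P_functor R)).
Proof.
exists (fun_hom P_functor (adj_counit Q_P_adjunction R)); split.
  exact: triangleR.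
by apply: gp_hom_eq; exact: gh_comp_id.
Qed.

Lemma P_Q_eq_of_unit_iso (G : GpdPreOrd) :
  is_iso (adj_unit Q_P_adjunction G) -> P_functor (Q_functor G) = G.
Proof.
move=> [g [/(congr1 (@gp_gh _ _)) gE _]].
apply: esym; apply: (@groupoid_preorder_eq _ _ (Q_unit G) g erefl) => //=.
(* [Q_unit G] is the identity of groupoids, so composing [g] with it leaves [g] unchanged, and [gE]
   says that [g] is the identity too. *)
by rewrite -[LHS]gh_comp_id.
Qed.

Theorem corollary11p5 (Q : functor GpdPreOrd Prd) (A : adjunction Q P_functor) :
  [/\ forall a : GpdPreOrd, inGpdPreOrdP a <-> is_iso (adj_unit A a),
      restricts_to_adjoint_equivalence A inGpdPreOrdP (inPrdF A)
    & forall R : Prd,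
        inPrdF A R <-> exists a : GpdPreOrd, inGpdPreOrdP a /\ isomorphic R (Q a)].
Proof.
have unitP a : inGpdPreOrdP a <-> is_iso (adj_unit A a).
  split=> [[R <-]|/(unit_iso_transfer Q_P_adjunction) /P_Q_eq_of_unit_iso aE].
    exact: unit_iso_transfer (Q_unit_iso_P R).
  (* The witness comes from the explicit [Q_functor], whatever [Q] is: an arbitrary left adjoint
     need only give [P_functor (Q a)] isomorphic to [a]. *)
  by exists (Q_functor a).
have inPQ a : inGpdPreOrdP a -> inPrdF A (Q a).
  by move=> /unitP; exact: counit_iso_of_unit_iso.
split=> // [|R].
  apply: restrict_adjoint_equivalence => // [R _|a /unitP //].
  by exists R.
split=> [eps_iso|[a [aP /isomorphic_sym Ra]]].
  (* The counit at [R] is itself an isomorphism from [Q (P_functor R)] to [R]. *)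
  exists (P_functor R); split; first by exists R.
  by apply: isomorphic_sym; exists (adj_counit A R).
exact: counit_iso_isomorphic Ra (inPQ a aP).
Qed.
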